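(* There exists a constant $c>0$ such that for every finite set $X$ with $|X|=n$ and every family $\mathcal R$ of subsets of $X$ with $|\mathcal R|> c n^{4-1/4}$, there exist three sets $R_1,R_2,R_3\in\mathcal R$ whose Venn diagram has all $8$ regions nonempty; that is, for every $S\subseteq\{1,2,3\}$ there is an element $x\in X$ with $x\in R_i \iff i\in S$ for all $i\in\{1,2,3\}$.
   Formalization: The formal theorem assumes that X is nonempty (n ≥ 1); for n = 0 the family {∅} has 1 > c·0 members but X has no elements, so the claim as stated fails there. *)

(* Defs.v *)
From mathcomp Require Import all_boot.
Set Implicit Arguments.
Unset Strict Implicit.
Unset Printing Implicit Defensive.

(* All 2 ^ k regions count, including the one outside every A i (S = set0);
   the index set {1, ..., k} is 'I_k, shifted to start from 0. *)
Definition full_venn (X : finType) (k : nat) (A : 'I_k -> {set X}) : Prop :=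
  forall S : {set 'I_k}, exists x : X, forall i : 'I_k, x \in A i <-> i \in S.

(* Main.v *)
Require Import Defs.
From HB Require Import structures.
From mathcomp Require Import all_boot zify ring lra.
Set Implicit Arguments.
Unset Strict Implicit.
Unset Printing Implicit Defensive.

(** Order X. If A, A + x both extend (above x) to members of F, say that A lies
    in [split_at x F]; then |F| <= 1 + sum_x |split_at x F|, and each region
    visible in [split_at x F] survives in F while x itself can be put in one
    more region. So if F has no three sets with 8 regions, the families
    [split_at w F] have no three sets with 7 regions, and after four splittings
    at w > x > y > z at most 8 sets remain. Up to O(n^3), |F| is thus at most 8
    times the number of (w, x, y, z) whose iterated splitting is nonempty. If
    |F| is much larger than n^(4 - 1/4), then for some w there are many more
    than n^(3 - 1/4) such triples (x, y, z), and by Kovari-Sos-Turan they contain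
    {x0, x1} * {y0, y1} * Z with Z as large as we like. Each of these triples
    yields 8 members of [split_at w F], in which the bits at x, y, z are free and
    the bit of any other point depends only on the free bits below it. By Ramsey
    the dependences are the same for all pairs of points of Z. Only finitely many
    patterns of dependence are left, and in each of them three members with 7
    regions can be found among x0, x1, y0, y1 and four points of Z. *)

(** * Ramsey and Kovari-Sos-Turan *)

Lemma pigeonhole_count (T : Type) (K : finType) (f : T -> K) (m : nat) (s : seq T) :
  #|K| * m < size s -> exists k, m < count (fun x => f x == k) s.
Proof.
move=> big; apply/existsP; apply: contraLR big; rewrite negb_exists -leqNgt.
move=> /forallP small.
have -> : size s = \sum_(k : K) count (fun x => f x == k) s.
  elim: s {small} => [|x s IHs] /=; first by rewrite big1.
  rewrite big_split /= -IHs (bigD1 (f x)) //= eqxx big1 ?addn0 // => k.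
  by rewrite eq_sym => /negPf->.
rewrite -sum_nat_const; apply: leq_sum => k _.
by rewrite leqNgt small.
Qed.

(** Keep the first element, restrict the rest to one large colour class of it, and repeat. Each
    chosen element records its colour towards all later ones. *)
Lemma prehomogeneous_subseq (K : finType) (t : nat) :
  exists N, forall (T : eqType) (col : T -> T -> K) (s : seq T), N <= size s ->
  exists2 s' : seq (T * K), subseq [seq p.1 | p <- s'] s /\ size s' = t &
    pairwise (fun p q => col p.1 q.1 == p.2) s'.
Proof.
elim: t => [|t [N IH]]; first by exists 0 => T col s _; exists [::]; rewrite ?sub0seq.
exists (#|K| * N).+2 => T col [//|a r]; rewrite /= !ltnS => /(@pigeonhole_count _ _ (col a)).
case=> k; rewrite -size_filter => /ltnW /(IH _ col) [s' [sub sz] pw].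
exists ((a, k) :: s').
  split; last by rewrite /= sz.
  by rewrite /= eqxx (subseq_trans sub) ?filter_subseq.
rewrite /= pw andbT; apply/allP => p ps /=.
have : p.1 \in [seq x <- r | col a x == k] by apply: (mem_subseq sub); apply: map_f.
by rewrite mem_filter => /andP[].
Qed.

(** In a long prehomogeneous sequence some recorded colour occurs more than [t] times. *)
Lemma ramsey_pairs (K : finType) (t : nat) :
  exists N, forall (T : eqType) (col : T -> T -> K) (s : seq T), N <= size s ->
  exists k s', [/\ subseq s' s, size s' = t & pairwise (fun x y => col x y == k) s'].
Proof.
have [N HN] := prehomogeneous_subseq K (#|K| * t).+1.
exists N => T col s /(HN _ col) [s' [sub sz] pw].
have [|k] := @pigeonhole_count _ K (fun p : T * K => p.2) t s'; first by rewrite sz.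
rewrite -size_filter; set s1 := filter _ _ => big.
have sub1 : subseq s1 s' by apply: filter_subseq.
exists k, (take t [seq p.1 | p <- s1]); split.
- apply: subseq_trans (take_subseq _ _) (subseq_trans (map_subseq _ sub1) sub).
- by rewrite size_takel // size_map ltnW.
apply: subseq_pairwise (take_subseq _ _) _; rewrite pairwise_map.
have := subseq_pairwise sub1 pw; rewrite /s1.
have : all (fun p => p.2 == k) s1 by apply: filter_all.
rewrite -/s1; elim: s1 {big sub1} => //= p l IH /andP[/eqP pk al] /andP[h1 h2].
by rewrite IH // andbT; move: h1; rewrite pk.
Qed.

Lemma sqr_sum_le (I : finType) (a : I -> nat) :
  (\sum_i a i) ^ 2 <= #|I| * \sum_i a i ^ 2.
Proof.
rewrite -(leq_pmul2l (isT : 0 < 2)) -mulnn.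
have -> : #|I| * \sum_i a i ^ 2 = \sum_i \sum_(j : I) a i ^ 2.
  by rewrite exchange_big sum_nat_const.
rewrite big_distrl /=.
have -> : 2 * \sum_i \sum_(j : I) a i ^ 2 = \sum_i \sum_j (a i ^ 2 + a j ^ 2).
  under [RHS]eq_bigr do rewrite big_split.
  by rewrite big_split /= [X in _ + X]exchange_big addnn -mul2n.
rewrite big_distrr leq_sum // => i _; rewrite big_distrr /= big_distrr leq_sum // => j _.
exact: nat_Cauchy.
Qed.

(* Cauchy-Schwarz is applied to double the first coordinate, and then again to
   double the second one. *)
Lemma kst_K22t (X : finType) (e : X -> X -> X -> bool) (t : nat) :
  t.+2 * #|X| ^ 11 < (\sum_x \sum_y \sum_z e x y z) ^ 4 ->
  exists x0 x1 y0 y1, [/\ x0 != x1, y0 != y1 &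
    t < #|[set z | [&& e x0 y0 z, e x0 y1 z, e x1 y0 z & e x1 y1 z]]|].
Proof.
set m := \sum_x _; set n := #|X|.
pose q x0 x1 y0 y1 z := [&& e x0 y0 z, e x0 y1 z, e x1 y0 z & e x1 y1 z].
pose Q := \sum_x0 \sum_x1 \sum_y0 \sum_y1 \sum_z q x0 x1 y0 y1 z.
pose S := \sum_x0 \sum_x1 \sum_y \sum_z (e x0 y z && e x1 y z).
have mS : m ^ 2 <= n ^ 2 * S.
  have -> : m = \sum_(p : X * X) \sum_x e x p.1 p.2.
    by rewrite exchange_big; apply: eq_bigr => x _; rewrite pair_bigA.
  apply: leq_trans (sqr_sum_le _) _; rewrite card_prod -/n mulnn leq_mul2l.
  apply/orP; right; apply: eq_leq.
  rewrite [S](eq_bigr (fun x0 => \sum_(p : X * X) \sum_x1 (e x0 p.1 p.2 && e x1 p.1 p.2))).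
    rewrite exchange_big; apply: eq_bigr => p _.
    rewrite -mulnn big_distrl; apply: eq_bigr => x0 _; rewrite big_distrr.
    by apply: eq_bigr => x1 _; exact: mulnb.
  move=> x0 _; rewrite [RHS]exchange_big; apply: eq_bigr => x1 _.
  by rewrite pair_bigA.
have SQ : S ^ 2 <= n ^ 3 * Q.
  have -> : S = \sum_(p : X * X * X) \sum_y (e p.1.1 y p.2 && e p.1.2 y p.2).
    rewrite /S pair_bigA /= .
    under eq_bigr do rewrite exchange_big.
    by rewrite pair_bigA.
  apply: leq_trans (sqr_sum_le _) _; rewrite !card_prod -/n mulnn -expnSr leq_mul2l.
  apply/orP; right; apply: eq_leq.
  have -> : Q = \sum_(p : X * X) \sum_z \sum_y0 \sum_y1 q p.1 p.2 y0 y1 z.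
    rewrite /Q pair_bigA; apply: eq_bigr => p _ /=.
    rewrite [RHS]exchange_big; apply: eq_bigr => y0 _.
    by rewrite exchange_big.
  rewrite pair_bigA; apply: eq_bigr => p _.
  rewrite -mulnn big_distrl; apply: eq_bigr => y0 _; rewrite big_distrr.
  apply: eq_bigr => y1 _; rewrite [LHS]mulnb /q /=; congr nat_of_bool.
  by do 4 case: (e _ _ _).
move=> big.
(* The two estimates give [m ^ 4 <= n ^ 4 * S ^ 2 <= n ^ 7 * Q], and 11 = 7 + 4. *)
have big' : t.+2 * n ^ 4 < Q.
  rewrite -(@ltn_pmul2l (n ^ 7)); last first.
    rewrite expn_gt0; case: posnP => // n0; move: big; rewrite /m big1 // => x _.
    by have := card0_eq n0 x; rewrite inE.
  rewrite mulnCA -expnD; apply: leq_trans big _.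
  rewrite -[4]/(2 * 2) expnM; apply: leq_trans (_ : (n ^ 2 * S) ^ 2 <= _).
    by rewrite leq_exp2r.
  by rewrite expnMn -expnM -[7]/(4 + 3) expnD -mulnA leq_mul2l SQ orbT.
pose P (p : X * X * X * X) := let: (x0, x1, y0, y1) := p in
  [&& x0 != x1, y0 != y1 & t < #|[set z | q x0 x1 y0 y1 z]|].
case: (boolP [exists p, P p]) => [/existsP[[[[x0 x1] y0] y1]] /and3P[xx yy tz]|].
  by exists x0, x1, y0, y1.
move=> /existsPn none; move: big'; rewrite ltnNge => /negP[].
(* Proper quadruples contribute at most [t], degenerate ones at most [n]. Each of the two
   degeneracies adds [n ^ 4] to the total, whence [t.+2]. *)
have bnd x0 x1 y0 y1 : \sum_z q x0 x1 y0 y1 z <= t + (x0 == x1) * n + (y0 == y1) * n.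
  have le_n : \sum_z q x0 x1 y0 y1 z <= n.
    rewrite /n -sum1_card leq_sum // => z _; exact: leq_b1.
  have [_|xx] := eqVneq x0 x1.
    by rewrite mul1n; apply: leq_trans le_n _; rewrite addnAC leq_addl.
  have [_|yy] := eqVneq y0 y1.
    by rewrite mul1n; apply: leq_trans le_n _; rewrite leq_addl.
  rewrite !mul0n !addn0; have := none (x0, x1, y0, y1).
  rewrite /P xx yy /= -leqNgt; apply: leq_trans; apply: eq_leq.
  by rewrite -sum1dep_card [RHS]big_mkcond; apply: eq_bigr => z _; rewrite /q; case: ifP.
apply: leq_trans (_ : \sum_x0 \sum_x1 \sum_y0 \sum_y1
  (t + (x0 == x1) * n + (y0 == y1) * n) <= _).
  by do 4 (apply: leq_sum => ? _).
have diag (x : X) : \sum_y (x == y) * n = n.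
  rewrite (bigD1 x) //= eqxx mul1n big1 ?addn0 // => y.
  by rewrite eq_sym => /negPf->.
under eq_bigr => x0 _.
  under eq_bigr => x1 _.
    under eq_bigr => y0 _.
      rewrite big_split /= diag sum_nat_const -/n.
      over.
    rewrite sum_nat_const -/n !mulnDr.
    over.
  rewrite !big_split /= !sum_nat_const -!big_distrr /= diag -/n.
  over.
rewrite sum_nat_const -/n; apply: eq_leq.
by rewrite !expnS expn0; nia.
Qed.

(** * Splitting a family *)

Lemma uniq_map_inj (T1 T2 : eqType) (f : T1 -> T2) (s : seq T1) :
  uniq [seq f x | x <- s] -> {in s &, injective f}.
Proof.
elim: s => // a s IH /= /andP[/mapP fa un] x y; rewrite !inE.
move=> /predU1P[->|xs] /predU1P[->|ys] // e; last exact: IH.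
  by case: fa; exists y.
by case: fa; exists x.
Qed.

Section Order.
Variable X : finType.
Implicit Types (x y z p : X) (A B C : {set X}) (F : {set {set X}}).

Definition rk x : nat := enum_rank x.
Definition below (m : nat) : {set X} := [set p | rk p < m].

Lemma rk_inj : injective rk.
Proof. by move=> x y /val_inj /enum_rank_inj. Qed.

Lemma rk_lt x : rk x < #|X|.
Proof. exact: ltn_ord. Qed.

Lemma belowS x : below (rk x).+1 = x |: below (rk x).
Proof. by apply/setP => p; rewrite !inE ltnS leq_eqVlt (inj_eq rk_inj). Qed.

Definition trace (m : nat) F : {set {set X}} := [set A :&: below m | A in F].

Definition split_at x F : {set {set X}} :=
  [set A : {set X} | (A \subset below (rk x)) &&
    [forall b : bool, exists B in F, (B :&: below (rk x) == A) && ((x \in B) == b)]].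

Lemma split_below x F A : A \in split_at x F -> A \subset below (rk x).
Proof. by rewrite inE => /andP[]. Qed.

Definition lift x F A (b : bool) : {set X} :=
  odflt set0 [pick B in F | (B :&: below (rk x) == A) && ((x \in B) == b)].

Lemma liftP x F A b : A \in split_at x F ->
  [/\ lift x F A b \in F, lift x F A b :&: below (rk x) = A & (x \in lift x F A b) = b].
Proof.
rewrite inE => /andP[_ /forallP /(_ b) ex]; rewrite /lift.
case: pickP => [B /and3P[BF /eqP BA /eqP Bx] //|none].
by case/existsP: ex => B; rewrite none.
Qed.

Lemma in_lift x F A b p : A \in split_at x F -> rk p < rk x ->
  (p \in lift x F A b) = (p \in A).
Proof.
by move=> /(liftP b)[_ e _] px; rewrite -[in RHS]e !inE px andbT.
Qed.

Lemma split_lt x m F A :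
  (forall B, B \in F -> B \subset below m) -> A \in split_at x F -> rk x < m.
Proof. by move=> sub /(liftP true)[/sub /subsetP BF _ /BF]; rewrite inE. Qed.

(** Take the traces below [x] of the members with [x] and of those without. Their union consists of
    traces of [F], their intersection of sets that extend both ways. *)
Lemma card_trace_step x F : #|trace (rk x).+1 F| <= #|trace (rk x) F| + #|split_at x F|.
Proof.
pose bx := below (rk x).
pose S b := [set B :&: bx | B in F & (x \in B) == b].
have S_I : S true :&: S false \subset split_at x F.
  apply/subsetP => A /setIP[/imsetP[B] + ->] /imsetP[B'].
  rewrite !inE => /andP[BF /eqP Bx] /andP[B'F /eqP B'x] eBB'.
  rewrite subsetIr; apply/forallP => -[]; apply/existsP.
    by exists B; rewrite BF eqxx Bx.
  by exists B'; rewrite B'F eBB' eqxx B'x.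
have S_U : S true :|: S false \subset trace (rk x) F.
  by apply/subsetP => A /setUP[] /imsetP[B + ->]; rewrite !inE => /andP[BF _]; apply: imset_f.
have sub : trace (rk x).+1 F \subset [set x |: A | A in S true] :|: S false.
  apply/subsetP => A /imsetP[B BF ->]; rewrite belowS inE.
  have [xB|xB] := boolP (x \in B); apply/orP; [left|right].
    rewrite setIUr (setIidPr _) ?sub1set //; apply: imset_f.
    by apply: imset_f; rewrite !inE BF xB.
  apply/imsetP; exists B; first by rewrite !inE BF (negPf xB).
  apply/setP => p; rewrite !inE; case: eqVneq => [->|//].
  by rewrite (negPf xB).
apply: leq_trans (subset_leq_card sub) _; apply: leq_trans (leq_card_setU _ _) _.
apply: leq_trans (leq_add (leq_imset_card _ _) (leqnn _)) _.
by rewrite -cardsUI leq_add ?subset_leq_card.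
Qed.

(** Adding points in order telescopes from the trace on no points, of size at most 1, to [F]
    itself. *)
Lemma card_split_sum F : #|F| <= 1 + \sum_x #|split_at x F|.
Proof.
have trE : trace #|X| F = F.
  rewrite /trace (_ : below _ = setT); last by apply/setP => p; rewrite !inE rk_lt.
  by under eq_imset => A do rewrite setIT; rewrite imset_id.
have tr0 : #|trace 0 F| <= 1.
  rewrite -(cards1 (set0 : {set X})); apply/subset_leq_card/subsetP => A /imsetP[B _ ->].
  by rewrite inE; apply/eqP/setP => p; rewrite !inE andbF.
have step m : m <= #|X| -> #|trace m F| <= 1 + \sum_(x | rk x < m) #|split_at x F|.
  elim: m => [|m IH] mX; first by apply: leq_trans tr0 _; rewrite leq_addr.
  pose x := enum_val (Ordinal mX).
  have xm : rk x = m by rewrite /rk enum_valK.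
  have := card_trace_step x F; rewrite xm => /leq_trans; apply.
  rewrite (bigD1 x) /=; last by rewrite xm.
  rewrite addnCA [X in X <= _]addnC leq_add2l; apply: leq_trans (IH (ltnW mX)) _.
  rewrite leq_add2l; apply: eq_leq; apply: eq_bigl => y.
  rewrite [in RHS]ltnS [in RHS]leq_eqVlt -xm (inj_eq rk_inj).
  by case: eqVneq => [->|]; rewrite ?ltnn ?andbF ?andbT.
rewrite -{1}trE; apply: leq_trans (step _ (leqnn _)) _.
by rewrite leq_add2l; apply: eq_leq; apply: eq_bigl => x; rewrite rk_lt.
Qed.

Definition region A B C p : bool * bool * bool := (p \in A, p \in B, p \in C).

Definition rich (k m : nat) F := exists A B C,
  [/\ A \in F, B \in F, C \in F & k <= #|[set region A B C p | p in below m]|].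

Lemma card_regions : #|{: bool * bool * bool}| = 8.
Proof. by rewrite !card_prod card_bool. Qed.

(* The bit at x of each lifted set is free, so x can take any missing region. *)
Lemma rich_split k x F : k < 8 -> rich k (rk x) (split_at x F) -> rich k.+1 (rk x).+1 F.
Proof.
move=> k8 [A [B [C [AF BF CF hk]]]].
set S := [set _ | _ in _] in hk.
(* If no region is missing, the default is harmless: all 8 are there already and [k < 8]. *)
pose r := odflt (false, false, false) [pick r | r \notin S].
exists (lift x F A r.1.1), (lift x F B r.1.2), (lift x F C r.2).
have [hA _ xA] := liftP r.1.1 AF; have [hB _ xB] := liftP r.1.2 BF.
have [hC _ xC] := liftP r.2 CF.
split=> //; apply: leq_trans (_ : #|r |: S| <= _).
  rewrite cardsU1 /r; case: pickP => [r' rS /=|none]; first by rewrite rS.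
  suff -> : S = setT by rewrite cardsT card_regions ltn_addl.
  by apply/setP => r'; have := none r'; rewrite !inE => /negbFE.
apply/subset_leq_card/subsetP => r' /setU1P[->|/imsetP[p px ->]]; apply/imsetP.
  exists x; first by rewrite belowS setU11.
  by rewrite /region xA xB xC; case: (r) => [[]].
exists p; first by rewrite belowS setU1r.
by move: px; rewrite inE => px; rewrite /region !in_lift.
Qed.

Lemma rich_mono k m m' F : m <= m' -> rich k m F -> rich k m' F.
Proof.
move=> mm [A [B [C [AF BF CF hk]]]]; exists A, B, C; split=> //; apply: leq_trans hk _.
apply/subset_leq_card/imsetS/subsetP => p; rewrite !inE => /leq_trans; exact.
Qed.

(** There are only [2 ^ size ps] bit vectors on [ps], so two distinct members share one. *)
Lemma separate (ps : seq X) F : 2 ^ size ps < #|F| ->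
  exists A B s, [/\ A \in F, B \in F, (s \in A) != (s \in B) &
    {in ps, forall p, (p \in A) = (p \in B)}].
Proof.
move=> big; pose f A := [tuple of [seq p \in A | p <- in_tuple ps]].
have /dinjectivePn [A AF [B /andP[/= AB BF] eqf]] : ~~ dinjectiveb f (mem F).
  apply/negP => /dinjectiveP /card_in_imset fF; move: big; rewrite -fF ltnNge => /negP[].
  by apply: leq_trans (max_card _) _; rewrite card_tuple card_bool.
have [s sAB] : exists s, (s \in A) != (s \in B).
  apply/existsP; apply: contraR AB => /existsPn same.
  by apply/eqP/setP => s; apply/esym/eqP; have := same s; rewrite negbK.
exists A, B, s; split=> // p /= pps.
have := congr1 val eqf => /= /eq_in_map; exact.
Qed.

(* Repeatedly, a new set separates a new point from all the earlier points. *)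
Lemma rich4 m F : (forall A, A \in F -> A \subset below m) -> 8 < #|F| -> rich 4 m F.
Proof.
move=> sub big.
pose bits (As : seq {set X}) p := [seq p \in A | A <- As].
have new_below A B s : A \in F -> B \in F -> (s \in A) != (s \in B) -> s \in below m.
  move=> /sub /subsetP sA /sub /subsetP sB.
  by case: (boolP (s \in A)) => [/sA //|_]; case: (boolP (s \in B)) => [/sB|].
have step As ps : size ps <= 3 -> uniq [seq bits As p | p <- ps] ->
    exists A s, [/\ A \in F, s \in below m & uniq [seq bits (A :: As) p | p <- s :: ps]].
  move=> sz un.
  have [|A [B [s [AF BF sAB agree]]]] := @separate ps F.
    by apply: leq_ltn_trans big; rewrite -[8]/(2 ^ 3) leq_exp2l.
  have sm := new_below _ _ _ AF BF sAB.
  have un' C : uniq [seq bits (C :: As) p | p <- ps].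
    have : uniq [seq behead r | r <- [seq bits (C :: As) p | p <- ps]] by rewrite -map_comp.
    exact: map_uniq.
  have [/mapP[p pps sp]|out] := boolP (bits As s \in [seq bits As p | p <- ps]); last first.
    exists A, s; split=> //=; rewrite un' andbT; apply: contra out => /mapP[p pps [_ e]].
    by apply/mapP; exists p.
  (* Now [s] looks like exactly one earlier point [p]. As [A] and [B] agree at [p] but differ at
     [s], one of them tells [s] from [p]. *)
  have fin C : C \in F -> (s \in C) != (p \in C) ->
      exists A s, [/\ A \in F, s \in below m & uniq [seq bits (A :: As) p | p <- s :: ps]].
    move=> CF sC; exists C, s; split=> //=; rewrite un' andbT.
    apply: contra sC => /mapP[p' p'ps [-> e]]; apply/eqP.
    by rewrite (uniq_map_inj un p'ps pps) // -e sp.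
  have := agree p pps; case: (eqVneq (s \in A) (p \in A)) => [sA|/(fin _ AF) //].
  by case: (eqVneq (s \in B) (p \in B)) => [sB|/(fin _ BF) //] AB; rewrite sA sB AB eqxx in sAB.
have [|A0 [B0 [p0 [A0F B0F AB0 _]]]] := @separate [::] F; first by apply: leq_trans big.
have p0m := new_below _ _ _ A0F B0F AB0.
have [//|//|A [p1 [AF p1m u1]]] := step [::] [:: p0].
have [//|//|B [p2 [BF p2m u2]]] := step [:: A] [:: p1; p0].
have [//|//|C [p3 [CF p3m u3]]] := step [:: B; A] [:: p2; p1; p0].
exists A, B, C; split=> //.
pose ps := [:: p3; p2; p1; p0].
have un : uniq [seq region A B C p | p <- ps].
  have : uniq [seq [:: r.2; r.1.2; r.1.1] | r <- [seq region A B C p | p <- ps]].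
    by rewrite -map_comp.
  exact: map_uniq.
rewrite -[4]/(size [seq region A B C p | p <- ps]) -(card_uniqP un).
apply/subset_leq_card/subsetP => r /mapP[p pps ->]; apply: imset_f.
by move: pps p0m p1m p2m p3m; rewrite !inE => /or4P[] /eqP->.
Qed.
End Order.

(** * The finite case analysis *)

Definition bools : seq bool := [:: false; true].

Definition regions : seq (bool * bool * bool) :=
  [seq (p, c) | p <- [seq (a, b) | a <- bools, b <- bools], c <- bools].

Definition eq_region (r s : bool * bool * bool) : bool :=
  let: (a, b, c) := r in let: (a', b', c') := s in
  if eqb a a' then if eqb b b' then eqb c c' else false else false.

(* In [has] and [all], call-by-value evaluation always traverses the whole list,
   since [||] and [&&] are functions; these versions stop early. *)
Fixpoint lazy_has (T : Type) (p : T -> bool) (s : seq T) : bool :=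
  if s is x :: s' then if p x then true else lazy_has p s' else false.
Fixpoint lazy_all (T : Type) (p : T -> bool) (s : seq T) : bool :=
  if s is x :: s' then if p x then lazy_all p s' else false else true.

Definition at_least_seven (s : seq (bool * bool * bool)) : bool :=
  6 < count (fun r => lazy_has (eq_region r) s) regions.

(* Let T be one of the sets built on a triple (x_i, y_j, z_k), with bit ~~ c at z_k,
   where c is the common bit at all z_l with l < k, and d the one at all z_l with
   l > k. Here x_0 < x_1, y_0 < y_1 and z_0 < ... < z_3, with [false] standing for 0
   in i and j. Then T has [membership (x0, x1, (y0, y1), (c, d)) k] as its list of bits
   at x_0, x_1, y_0, y_1, z_0, ..., z_3. *)
Definition zbit (c d : bool) (k l : nat) : bool :=
  if l < k then c else if l == k then ~~ c else d.

Definition local_data := (bool * bool * (bool * bool) * (bool * bool))%type.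

Definition membership (e : local_data) (k : nat) : seq bool :=
  let: (x0, x1, (y0, y1), (c, d)) := e in
  [:: x0; x1; y0; y1; zbit c d k 0; zbit c d k 1; zbit c d k 2; zbit c d k 3].

Definition regions_of (e f g : seq bool) : seq (bool * bool * bool) := zip (zip e f) g.

Definition e0 : local_data := (false, false, (false, false), (false, false)).

Definition wins (es : seq local_data) (t : nat * nat * nat * (nat * nat * nat)) : bool :=
  let: (u, v, w, (k, l, m)) := t in
  at_least_seven (regions_of (membership (nth e0 es u) k) (membership (nth e0 es v) l)
    (membership (nth e0 es w) m)).

(* In an entry (u, v, w, (k, l, m)) the u-th, v-th and w-th sets are built on z_k, z_l
   and z_m. The three lists were found by a greedy computer search: the first
   settles all but 60 of the 8192 cases for the bases (x_0, y_0), (x_1, y_1), the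
   second all but 72 of those for (x_0, y_1), (x_1, y_0), and the third all
   combinations of cases left open. *)
Definition winning_triples_diag : seq (nat * nat * nat * (nat * nat * nat)) :=
  [:: (5,6,7,(1,2,3)); (4,5,6,(3,2,1)); (1,2,3,(1,2,3)); (0,1,2,(3,2,1));
    (1,2,7,(3,2,1)); (3,5,6,(1,3,2)); (0,5,6,(1,3,2)); (1,2,4,(2,3,1));
    (0,5,6,(3,1,2)); (2,3,4,(1,2,3)); (1,5,6,(3,1,2)); (2,3,7,(1,3,2));
    (3,4,7,(2,1,3)); (0,2,4,(3,1,2)); (2,3,7,(3,1,1)); (0,1,4,(1,3,2));
    (0,1,7,(1,3,2)); (1,3,4,(3,1,1)); (0,2,7,(3,1,2)); (3,6,7,(2,3,1));
    (1,3,6,(1,2,3)); (0,1,4,(1,3,1)); (3,4,5,(1,1,3)); (0,6,7,(1,3,1));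
    (0,4,6,(2,1,3)); (1,3,7,(2,1,3)); (2,3,5,(1,3,2)); (0,6,7,(2,1,3));
    (2,3,4,(3,1,1)); (0,1,7,(3,2,3)); (0,2,4,(1,3,1)); (0,2,5,(2,1,3));
    (3,4,6,(1,2,3)); (0,2,4,(1,3,2)); (1,3,5,(3,1,2)); (1,3,4,(2,1,3));
    (3,6,7,(1,3,1)); (0,5,7,(2,2,3)); (1,3,7,(2,3,3)); (0,2,7,(3,2,3));
    (2,4,5,(2,1,3)); (0,4,5,(2,2,3)); (3,5,7,(2,2,3)); (0,4,6,(2,2,3));
    (0,2,3,(1,3,2)); (0,2,3,(2,3,1)); (3,5,7,(3,2,3)); (0,5,7,(3,2,3));
    (3,4,6,(2,2,3)); (0,2,3,(2,1,3)); (3,4,7,(2,3,1)); (0,1,5,(1,3,1));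
    (3,6,7,(3,1,2)); (2,4,7,(1,2,3))].

Definition winning_triples_antidiag : seq (nat * nat * nat * (nat * nat * nat)) :=
  [:: (1,2,6,(1,2,3)); (1,2,4,(3,2,1)); (1,2,3,(3,2,1)); (5,6,7,(3,2,1));
    (4,5,6,(1,2,3)); (0,1,2,(3,2,1)); (1,2,7,(1,2,3)); (1,2,7,(3,2,1));
    (0,4,5,(2,1,3)); (3,4,5,(2,3,1)); (0,6,7,(2,3,1)); (3,4,5,(1,1,3));
    (1,6,7,(2,1,3)); (1,5,7,(2,3,1)); (2,4,6,(2,3,1)); (2,5,7,(3,1,2));
    (0,2,4,(1,3,1)); (0,6,7,(1,3,1)); (1,3,7,(3,1,1)); (2,3,7,(1,2,2));
    (1,4,6,(2,1,3)); (3,6,7,(2,3,1)); (2,3,4,(1,3,2)); (0,4,5,(2,2,3));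
    (0,2,7,(1,3,1)); (2,3,4,(3,1,1)); (3,5,7,(1,2,3)); (0,5,7,(1,2,3));
    (0,4,6,(2,2,3)); (3,6,7,(1,3,1)); (3,4,5,(2,1,3)); (1,3,4,(1,2,3));
    (0,5,7,(3,2,3)); (0,4,6,(1,2,3)); (3,5,7,(3,2,3)); (0,1,7,(1,3,1));
    (2,6,7,(2,3,1)); (3,4,6,(1,2,3)); (0,1,4,(3,2,3)); (1,3,4,(3,1,1));
    (2,4,7,(1,2,3)); (1,4,7,(1,2,3)); (3,4,6,(2,2,3)); (0,2,3,(2,1,3));
    (0,2,3,(3,1,2)); (3,6,7,(2,1,3)); (1,6,7,(2,3,1)); (0,6,7,(2,1,3));
    (0,4,7,(2,3,1)); (0,2,3,(1,3,2)); (0,2,3,(2,3,1))].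

Definition winning_triples_all : seq (nat * nat * nat * (nat * nat * nat)) :=
  [:: (4,11,12,(3,1,1)); (7,11,12,(3,1,1)); (7,11,15,(3,1,1));
    (4,8,12,(3,1,1)); (4,8,15,(3,1,1)); (7,8,12,(3,1,1)); (7,8,15,(3,1,1));
    (4,11,15,(3,1,1)); (0,13,14,(1,3,2)); (3,13,14,(1,3,2)); (4,8,15,(3,2,1));
    (4,11,15,(3,2,1)); (4,11,12,(3,2,1)); (7,12,14,(2,1,3)); (4,8,12,(3,1,2));
    (7,11,15,(3,2,1)); (7,8,15,(3,2,1)); (7,12,15,(1,2,3)); (7,11,12,(1,3,2));
    (7,8,12,(1,3,2)); (4,12,15,(1,2,3)); (4,11,12,(1,3,2))].

(* With the free bits a at x_i and b at y_j, the bit at the other x is Z a b and the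
   one at the other y is Y b. If i is 1, then the other x is below x_i, so that its bit
   does not depend on a; likewise Y is constant if j is 1. *)
Definition local_data_at (i j : bool) (c d : bool) (Y : bool -> bool) (Z : bool -> bool -> bool)
    (a b : bool) : local_data :=
  ((if i then Z a b else a), (if i then a else Z a b),
   ((if j then Y b else b), (if j then b else Y b)), (c, d)).

Definition block i j c d Y Z : seq local_data :=
  [seq local_data_at i j c d Y Z a b | a <- bools, b <- bools].

Definition both (T : Type) (f : bool -> seq T) : seq T := f false ++ f true.

Definition tabulate (u v : bool) (b : bool) : bool := if b then v else u.

(** Tables in which a point below the base depends on the bit at the base are discarded. This leaves
    256, 128, 64 and 32 blocks for (i, j) = (0, 0), (0, 1), (1, 0), (1, 1). *)
Definition blocks (i j : bool) : seq (seq local_data) :=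
  both (fun c => both (fun d => both (fun y0 => both (fun y1 =>
  both (fun z00 => both (fun z01 => both (fun z10 => both (fun z11 =>
    if j && (y0 (+) y1) || i && ((z00 (+) z10) || (z01 (+) z11)) then [::] else
    [:: block i j c d (tabulate y0 y1)
      (fun a => if a then tabulate z10 z11 else tabulate z00 z01)])))))))).

Definition sums (s t : seq (seq local_data)) : seq (seq local_data) :=
  [seq x ++ y | x <- s, y <- t].

(** Testing each half alone first leaves 60 * 72 combinations of open cases instead of
    [8192 ^ 2]. *)
Definition all_blocks_win : bool :=
  let bad := [seq y <- sums (blocks false true) (blocks true false)
                | ~~ lazy_has (wins y) winning_triples_antidiag] in
  lazy_all (fun x => if lazy_has (wins x) winning_triples_diag then true
      else lazy_all (fun y => lazy_has (wins (x ++ y)) winning_triples_all) bad)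
    (sums (blocks false false) (blocks true true)).

Lemma lazy_hasE (T : Type) (p : T -> bool) (s : seq T) : lazy_has p s = has p s.
Proof. by elim: s => //= x s ->. Qed.

Lemma lazy_allE (T : Type) (p : T -> bool) (s : seq T) : lazy_all p s = all p s.
Proof. by elim: s => //= x s ->. Qed.

Lemma all_blocks_win_true : all_blocks_win.
Proof. by vm_compute. Qed.

Lemma mem_both (T : eqType) (f : bool -> seq T) (x : T) b : x \in f b -> x \in both f.
Proof. by rewrite mem_cat; case: b => ->; rewrite ?orbT. Qed.

Lemma mem_blocks (i j c d : bool) (Y : bool -> bool) (Z : bool -> bool -> bool) :
  (j -> Y true = Y false) -> (i -> forall b, Z true b = Z false b) ->
  block i j c d Y Z \in blocks i j.
Proof.
move=> hY hZ.
apply: (@mem_both _ _ _ c); apply: (@mem_both _ _ _ d).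
apply: (@mem_both _ _ _ (Y false)); apply: (@mem_both _ _ _ (Y true)).
apply: (@mem_both _ _ _ (Z false false)); apply: (@mem_both _ _ _ (Z false true)).
apply: (@mem_both _ _ _ (Z true false)); apply: (@mem_both _ _ _ (Z true true)).
case: ifP => [|_]; last by rewrite inE.
by case: j i hY hZ => [] [] //= hY hZ; rewrite ?hY // ?hZ // !addbb.
Qed.

Definition label := (bool * bool * (bool * bool))%type.

Definition labels : seq label :=
  [seq (false, false, p) | p <- [seq (a, b) | a <- bools, b <- bools]] ++
  [seq (true, true, p) | p <- [seq (a, b) | a <- bools, b <- bools]] ++
  [seq (false, true, p) | p <- [seq (a, b) | a <- bools, b <- bools]] ++
  [seq (true, false, p) | p <- [seq (a, b) | a <- bools, b <- bools]].

Definition in_range (n : nat) (t : nat * nat * nat * (nat * nat * nat)) : bool :=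
  let: (u, v, w, (k, l, m)) := t in
  [&& u < n, v < n, w < n, k < 4, l < 4 & m < 4].

Definition shift_by_8 (t : nat * nat * nat * (nat * nat * nat)) :=
  let: (u, v, w, p) := t in (8 + u, 8 + v, 8 + w, p).

Lemma wins_cat (es es' : seq local_data) t :
  in_range (size es) t -> wins (es ++ es') t = wins es t.
Proof.
case: t => [[[u v] w] [[k l] m]] /and4P[u8 v8 w8 _].
by rewrite /wins; cbv beta iota; rewrite !nth_cat u8 v8 w8.
Qed.

Lemma wins_shift_by_8 (es es' : seq local_data) t :
  size es = 8 -> wins (es ++ es') (shift_by_8 t) = wins es' t.
Proof.
case: t => [[[u v] w] [[k l] m]] sz.
by rewrite /wins /shift_by_8; cbv beta iota; rewrite !nth_cat sz !ltnNge !leq_addr /= !addKn.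
Qed.

(** Whatever the dependences at the four bases, their blocks are among the computed ones. A winning
    triple of indices is then read back through [labels], whose order is that of the concatenated
    blocks. *)
Lemma seven_regions (c d : bool -> bool -> bool) (Y : bool -> bool -> bool -> bool)
    (Z : bool -> bool -> bool -> bool -> bool) :
  (forall i, Y i true true = Y i true false) ->
  (forall j b, Z true j true b = Z true j false b) ->
  let L (p : label) := let: (i, j, (a, b)) := p in
    local_data_at i j (c i j) (d i j) (Y i j) (Z i j) a b in
  exists p q r k l m, [/\ k < 4, l < 4, m < 4 &
    at_least_seven (regions_of (membership (L p) k) (membership (L q) l) (membership (L r) m))].
Proof.
move=> hY hZ L.
pose B i j := block i j (c i j) (d i j) (Y i j) (Z i j).
pose es := [seq L p | p <- labels].
have esE : es = (B false false ++ B true true) ++ (B false true ++ B true false) by [].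
have memB i j : B i j \in blocks i j.
  by apply: mem_blocks; [case: j => // _; exact: hY | case: i => // _; exact: hZ].
suff [t tr] : exists2 t, in_range 16 t & wins es t.
  case: t tr => [[[u v] w] [[k l] m]] /and5P[u16 v16 w16 k4 /andP[l4 m4]].
  pose p0 : label := (false, false, (false, false)).
  rewrite /wins !(nth_map p0) // => win.
  by exists (nth p0 labels u), (nth p0 labels v), (nth p0 labels w), k, l, m.
have := all_blocks_win_true; rewrite /all_blocks_win lazy_allE.
move=> /allP /(_ (B false false ++ B true true)).
have -> : B false false ++ B true true \in sums (blocks false false) (blocks true true).
  exact: allpairs_f.
move=> /(_ isT); rewrite lazy_hasE.
have rangeA : all (in_range 8) winning_triples_diag by [].
have rangeB : all (in_range 16) [seq shift_by_8 t | t <- winning_triples_antidiag] by [].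
have rangeAB : all (in_range 16) winning_triples_all by [].
case: ifPn => [/hasP[t tA win] _|_].
  have t8 := allP rangeA _ tA.
  exists t; last by rewrite esE wins_cat.
  by case: t t8 {tA win} => [[[u v] w] [[k l] m]] /and4P[u8 v8 w8 klm]; apply/and4P; split;
    rewrite // (leq_trans _ (isT : 8 <= 16)).
rewrite lazy_allE => /allP /(_ (B false true ++ B true false)).
rewrite mem_filter lazy_hasE.
have -> : B false true ++ B true false \in sums (blocks false true) (blocks true false).
  exact: allpairs_f.
rewrite andbT; case: hasP => [[t tB win] _|_ /(_ isT)].
  exists (shift_by_8 t); first exact/(allP rangeB)/map_f.
  by rewrite esE wins_shift_by_8.
rewrite lazy_hasE -esE => /hasP[t tAB win].
by exists t => //; exact: (allP rangeAB).
Qed.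

(** * Regions in a complete tripartite system *)

(** Repetitions in [ps] do no harm, since [at_least_seven] counts the distinct regions that
    occur. *)
Lemma rich_at_least_seven (X : finType) (m : nat) (F : {set {set X}}) (A B C : {set X})
    (ps : seq X) :
  A \in F -> B \in F -> C \in F -> {subset ps <= below X m} ->
  at_least_seven (regions_of [seq p \in A | p <- ps] [seq p \in B | p <- ps]
    [seq p \in C | p <- ps]) ->
  rich 7 m F.
Proof.
move=> AF BF CF sub win; exists A, B, C; split=> //.
have zipE : regions_of [seq p \in A | p <- ps] [seq p \in B | p <- ps] [seq p \in C | p <- ps]
    = [seq region A B C p | p <- ps].
  by rewrite /regions_of; elim: ps {sub win} => //= p ps <-.
move: win; rewrite zipE /at_least_seven -size_filter => /leq_trans; apply.
have un : uniq [seq r <- regions | lazy_has (eq_region r) [seq region A B C p | p <- ps]].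
  by rewrite filter_uniq.
rewrite -(card_uniqP un); apply/subset_leq_card/subsetP => r.
rewrite mem_filter lazy_hasE => /andP[/hasP[r' /mapP[p pps ->]] + _].
move=> eq_r; apply/imsetP; exists p; first exact: sub.
case: r eq_r => [[a b] c]; rewrite /region /=.
by case: a b c (_ \in A) (_ \in B) (_ \in C) => [] [] [] [] [] [].
Qed.

Section Tripartite.
Variables (X : finType) (m : nat) (F : {set {set X}}) (x y : bool -> X).
Hypothesis F_below : forall A, A \in F -> A \subset below X m.
Hypothesis x01 : rk (x false) < rk (x true).
Hypothesis y01 : rk (y false) < rk (y true).

Let S1 i := split_at (x i) F.
Let S2 i j := split_at (y j) (S1 i).
Let S3 i j z := split_at z (S2 i j).

(** One set of each triple splitting is chosen and lifted back to [F] through z, y_j and x_i. The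
    bits [s], [b], [a] inserted there are free, and a lift changes no bit below its point. *)
Let T0 i j z := odflt set0 [pick A in S3 i j z].
Let T1 i j z s := lift z (S2 i j) (T0 i j z) s.
Let T2 i j z s b := lift (y j) (S1 i) (T1 i j z s) b.
Let T3 i j z s a b := lift (x i) F (T2 i j z s b) a.

Variable Z : {set X}.
Hypothesis Z_edge : forall z i j, z \in Z -> S3 i j z != set0.

Lemma T0P z i j : z \in Z -> T0 i j z \in S3 i j z.
Proof.
move=> /Z_edge - /(_ i j) /set0Pn [A AS]; rewrite /T0.
by case: pickP => [//|/(_ A)]; rewrite AS.
Qed.

Lemma T1P z i j s : z \in Z -> T1 i j z s \in S2 i j.
Proof. by move=> /(T0P i j) /(liftP s)[]. Qed.

Lemma T2P z i j s b : z \in Z -> T2 i j z s b \in S1 i.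
Proof. by move=> /(T1P i j s) /(liftP b)[]. Qed.

Lemma T3P z i j s a b : z \in Z -> T3 i j z s a b \in F.
Proof. by move=> /(T2P i j s b) /(liftP a)[]. Qed.

(** A nonempty splitting happens only at a point of some member, and its sets lie below that point.
    Hence z < y_j < x_i < m for all z in [Z]. *)
Lemma x_lt z i : z \in Z -> rk (x i) < m.
Proof. by move=> /(T2P i true true true) /split_lt; apply. Qed.

Lemma y_lt z i j : z \in Z -> rk (y j) < rk (x i).
Proof. by move=> /(T1P i j true) /split_lt; apply => B /split_below. Qed.

Lemma z_lt z j : z \in Z -> rk z < rk (y j).
Proof. by move=> /(T0P true j) /split_lt; apply => B /split_below. Qed.

Lemma in_T3_x z i j s a b : z \in Z -> (x i \in T3 i j z s a b) = a.
Proof. by move=> /(T2P i j s b) /(liftP a)[]. Qed.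

Lemma in_T3 z i j s a b p : z \in Z -> rk p < rk (x i) ->
  (p \in T3 i j z s a b) = (p \in T2 i j z s b).
Proof. by move=> zZ px; apply: in_lift => //; apply: T2P. Qed.

Lemma in_T2_y z i j s b : z \in Z -> (y j \in T2 i j z s b) = b.
Proof. by move=> /(T1P i j s) /(liftP b)[]. Qed.

Lemma in_T2 z i j s b p : z \in Z -> rk p < rk (y j) ->
  (p \in T2 i j z s b) = (p \in T1 i j z s).
Proof. by move=> zZ px; apply: in_lift => //; apply: T1P. Qed.

Lemma in_T1_z z i j s : z \in Z -> (z \in T1 i j z s) = s.
Proof. by move=> /(T0P i j) /(liftP s)[]. Qed.

Lemma in_T1 z i j s p : z \in Z -> rk p < rk z -> (p \in T1 i j z s) = (p \in T0 i j z).
Proof. by move=> zZ px; apply: in_lift => //; apply: T0P. Qed.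

Definition pattern : finType :=
  {ffun bool * bool * bool * bool * bool -> bool * bool * bool * bool}.

(* The first two components do not involve z', but recording them too lets a single
   application of Ramsey make everything uniform. *)
Definition interaction (z z' : X) : pattern :=
  [ffun t => let: (i, j, a, b, s) := t in
    (x (~~ i) \in T3 i j z s a b, y (~~ j) \in T2 i j z s b,
     z' \in T1 i j z s, z \in T0 i j z')].

(** Four of the points carry the regions. The fifth ensures that each of them has a later point
    through which [kappa] describes it. *)
Lemma rich_homogeneous (zs : seq X) (kappa : pattern) :
  size zs = 5 -> {subset zs <= Z} ->
  pairwise (fun z z' => rk z < rk z') zs ->
  pairwise (fun z z' => interaction z z' == kappa) zs ->
  rich 7 m F.
Proof.
move=> sz sub.
set z0 := x true; pose z k := nth z0 zs k.
have zZ k : k < 5 -> z k \in Z by move=> k5; apply/sub/mem_nth; rewrite sz.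
move=> /(pairwiseP z0) lt_z /(pairwiseP z0) col_z.
have zlt k l : k < l -> l < 5 -> rk (z k) < rk (z l).
  by move=> kl l5; apply: lt_z; rewrite ?inE ?sz // (ltn_trans kl).
have zcol k l i j a b s : k < l -> l < 5 ->
    kappa (i, j, a, b, s) = (x (~~ i) \in T3 i j (z k) s a b, y (~~ j) \in T2 i j (z k) s b,
     z l \in T1 i j (z k) s, z k \in T0 i j (z l)).
  move=> kl l5; have /eqP <- : interaction (z k) (z l) == kappa.
    by apply: col_z; rewrite ?inE ?sz // (ltn_trans kl).
  by rewrite ffunE.
(* The bits below z_k are fixed in [T0] already, so the arguments [true] are arbitrary. The bit [s]
   at z_k is chosen opposite to [c], as in [zbit]. *)
pose c i j := (kappa (i, j, true, true, true)).2.
pose s i j := ~~ c i j.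
pose d i j := (kappa (i, j, true, true, s i j)).1.2.
pose Y i j b := (kappa (i, j, true, b, s i j)).1.1.2.
pose W i j a b := (kappa (i, j, a, b, s i j)).1.1.1.
have z0Z : z 0 \in Z by apply: zZ.
(* At a base of index 1 the other point is lower, so the lift at the base leaves its bit alone. *)
have indY i : Y i true true = Y i true false.
  by rewrite /Y !(@zcol 0 1) //= !in_T2.
have indW j b : W true j true b = W true j false b.
  by rewrite /W !(@zcol 0 1) //= !in_T3.
pose ps := [:: x false; x true; y false; y true; z 0; z 1; z 2; z 3].
pose L (p : label) := let: (i, j, (a, b)) := p in
  local_data_at i j (c i j) (d i j) (Y i j) (W i j) a b.
pose R (p : label) k := let: (i, j, (a, b)) := p in T3 i j (z k) (s i j) a b.
have RF p k : k < 4 -> R p k \in F.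
  by case: p => [[i j] [a b]] k4; apply/T3P/zZ/ltnW.
have RL p k : k < 4 -> [seq q \in R p k | q <- ps] = membership (L p) k.
  case: p => [[i j] [a b]] k4.
  have zk : z k \in Z by apply/zZ/ltnW.
  have xW : (x (~~ i) \in T3 i j (z k) (s i j) a b) = W i j a b.
    by rewrite /W (@zcol k 4).
  have yY : (y (~~ j) \in T3 i j (z k) (s i j) a b) = Y i j b.
    by rewrite in_T3 ?(y_lt _ _ zk) // /Y (@zcol k 4).
  have yb : (y j \in T3 i j (z k) (s i j) a b) = b.
    by rewrite in_T3 ?(y_lt _ _ zk) // in_T2_y.
  have zz l : l < 4 -> (z l \in T3 i j (z k) (s i j) a b) = zbit (c i j) (d i j) k l.
    move=> l4; have zl : z l \in Z by apply/zZ/ltnW.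
    rewrite in_T3 ?(ltn_trans (z_lt j zl) (y_lt _ _ zl)) // in_T2 ?z_lt //.
    rewrite /zbit; case: ltngtP => [lk|kl|->].
    - rewrite in_T1 //; last exact: zlt lk (ltnW k4).
      by rewrite /c (@zcol l k) //; apply: ltnW k4.
    - by rewrite /d (@zcol k l) //; apply: ltnW l4.
    - by rewrite in_T1_z.
  rewrite /membership /L /local_data_at /ps /= !zz //.
  by move: xW yY yb; rewrite /R; case: (i); case: (j) => /= -> -> ->; rewrite in_T3_x.
have [p [q [r [k [l [n [k4 l4 n4]]]]]]] := seven_regions c d indY indW.
rewrite -!RL //; apply: rich_at_least_seven; rewrite ?RF //.
move=> q'; have lt_x i : rk (x i) < m by apply: x_lt z0Z.
have lt_y j : rk (y j) < m by apply: ltn_trans (y_lt true j z0Z) (lt_x _).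
have lt_k k' : k' < 4 -> rk (z k') < m.
  by move=> /ltnW /zZ zk; apply: ltn_trans (z_lt true zk) (lt_y _).
rewrite !inE => /or4P[/eqP->|/eqP->|/eqP->|/or4P[/eqP->|/eqP->|/eqP->|/orP[/eqP->|/eqP->]]].
all: by first [exact: lt_x | exact: lt_y | exact: lt_k].
Qed.

End Tripartite.

(** [rk] is the position in [enum X], of which [enum Z] is a filtering. *)
Lemma pairwise_enum (X : finType) (Z : {set X}) : pairwise (fun z z' => rk z < rk z') (enum Z).
Proof.
apply: pairwise_filter; rewrite -enumT.
case: (pickP X) => [x0 _|X0]; last by rewrite (eq_enum X0) enum0.
apply/(pairwiseP x0) => k l; rewrite !inE -cardE => kX lX kl.
have rk_nth h (hX : h < #|X|) : rk (nth x0 (enum X) h) = h.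
  by rewrite -(enum_val_nth x0 (Ordinal hX)) /rk enum_valK.
by rewrite !rk_nth.
Qed.

Definition edge (X : finType) (F : {set {set X}}) (x y z : X) : bool :=
  split_at z (split_at y (split_at x F)) != set0.

Definition common (X : finType) (e : X -> X -> X -> bool) (x0 x1 y0 y1 : X) : {set X} :=
  [set z | [&& e x0 y0 z, e x0 y1 z, e x1 y0 z & e x1 y1 z]].

Lemma in_common (X : finType) (e : X -> X -> X -> bool) x0 x1 y0 y1 z :
  (z \in common e x0 x1 y0 y1) = [&& e x0 y0 z, e x0 y1 z, e x1 y0 z & e x1 y1 z].
Proof. by rewrite inE. Qed.

Lemma commonCl (X : finType) (e : X -> X -> X -> bool) x0 x1 y0 y1 :
  common e x0 x1 y0 y1 = common e x1 x0 y0 y1.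
Proof. by apply/setP => z; rewrite !inE; do 4 case: (e _ _ _). Qed.

Lemma commonCr (X : finType) (e : X -> X -> X -> bool) x0 x1 y0 y1 :
  common e x0 x1 y0 y1 = common e x0 x1 y1 y0.
Proof. by apply/setP => z; rewrite !inE; do 4 case: (e _ _ _). Qed.

(** The colours form the fixed finite type [pattern], so the Ramsey bound [N] does not depend on
    [X]. The symmetries of [common] allow both pairs to be ordered. *)
Lemma rich_tripartite : exists N,
  forall (X : finType) (m : nat) (F : {set {set X}}) (x0 x1 y0 y1 : X),
  (forall A, A \in F -> A \subset below X m) -> x0 != x1 -> y0 != y1 ->
  N < #|common (edge F) x0 x1 y0 y1| ->
  rich 7 m F.
Proof.
have [N HN] := ramsey_pairs pattern 5; exists N => X m F x0 x1 y0 y1 sub.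
wlog x01 : x0 x1 / rk x0 < rk x1.
  move=> th xx yy big; have [lt|lt|eqx] := ltngtP (rk x0) (rk x1).
  - exact: th lt xx yy big.
  - by apply: (th x1 x0 lt _ yy); [rewrite eq_sym | rewrite commonCl].
  - by rewrite (rk_inj eqx) eqxx in xx.
wlog y01 : y0 y1 / rk y0 < rk y1.
  move=> th xx yy big; have [lt|lt|eqy] := ltngtP (rk y0) (rk y1).
  - exact: th lt xx yy big.
  - by apply: (th y1 y0 lt xx); [rewrite eq_sym | rewrite commonCr].
  - by rewrite (rk_inj eqy) eqxx in yy.
move=> _ _; set Z := common _ _ _ _ _ => big.
pose x b := if b then x1 else x0; pose y b := if b then y1 else y0.
have Z_edge z i j : z \in Z -> edge F (x i) (y j) z.
  rewrite in_common => /and4P[e00 e01 e10 e11].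
  by case: i; case: j; [exact: e11 | exact: e10 | exact: e01 | exact: e00].
have [|kappa [zs [subz sz pw]]] := HN X (interaction F x y) (enum Z).
  by rewrite -cardE ltnW.
apply: (@rich_homogeneous _ _ _ x y sub x01 y01 Z Z_edge zs kappa) => //.
  by move=> z /(mem_subseq subz); rewrite mem_enum.
exact: subseq_pairwise subz (pairwise_enum Z).
Qed.

(** * Counting *)

Lemma rich_split_below (X : finType) (m k : nat) (F : {set {set X}}) (x : X) :
  (forall A, A \in F -> A \subset below X m) -> k < 8 ->
  rich k (rk x) (split_at x F) -> rich k.+1 m F.
Proof.
move=> sub k8 rx; have [A [_ [_ [AF _ _ _]]]] := rx.
by apply: rich_mono (rich_split k8 rx); apply: split_lt sub AF.
Qed.

(** A triple splitting with more than 8 sets would show 4 regions, and its three points would add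
    one each, giving 7. The lower-order terms collect the 1 lost at each splitting. *)
Lemma card_le_edges (X : finType) (m : nat) (F : {set {set X}}) :
  (forall A, A \in F -> A \subset below X m) -> ~ rich 7 m F ->
  #|F| <= 1 + #|X| + #|X| ^ 2 + 8 * \sum_x \sum_y \sum_z edge F x y z.
Proof.
move=> sub nrich.
have le8 x y z : #|split_at z (split_at y (split_at x F))| <= 8 * edge F x y z.
  rewrite /edge; case: eqVneq => [->|_]; first by rewrite cards0.
  rewrite leqNgt; apply/negP => /(rich4 (@split_below _ z _)) r4; apply: nrich.
  apply: (@rich_split_below _ _ _ _ x) => //.
  apply: (@rich_split_below _ _ _ _ y) => //; first exact: split_below.
  by apply: (@rich_split_below _ _ _ _ z) => //; exact: split_below.
have bound (G : {set {set X}}) (f : X -> nat) :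
    (forall x, #|split_at x G| <= f x) -> #|G| <= 1 + \sum_x f x.
  move=> le_f; apply: leq_trans (card_split_sum G) _.
  by rewrite leq_add2l leq_sum.
have h1 x : #|split_at x F| <= 1 + \sum_y (1 + \sum_z 8 * edge F x y z).
  by apply: (bound _) => y; apply: (bound _) => z; apply: le8.
apply: leq_trans (bound F _ h1) _; rewrite !big_split /= !sum_nat_const muln1.
under [X in _ + (_ + X)]eq_bigr => x _.
  rewrite big_split /= sum_nat_const muln1.
  under [X in _ + X]eq_bigr do rewrite -big_distrr /=.
  rewrite -big_distrr /=.
  over.
by rewrite big_split /= sum_nat_const -big_distrr /= !addnA.
Qed.

(** After one splitting at [w], [e w] counts the edges; too many of them would force a common
    neighbourhood above the Ramsey bound [N], so [K] is [N.+2]. *)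
Lemma card_not_rich : exists K, forall (X : finType) (F : {set {set X}}), ~ rich 8 #|X| F ->
  exists2 e : X -> nat, (forall w, e w ^ 4 <= K * #|X| ^ 11) &
    #|F| <= 1 + \sum_w (1 + #|X| + #|X| ^ 2 + 8 * e w).
Proof.
have [N HN] := rich_tripartite; exists N.+2 => X F nrich.
have sub A : A \in F -> A \subset below X #|X|.
  by move=> _; apply/subsetP => p _; rewrite inE rk_lt.
have nrich7 w : ~ rich 7 (rk w) (split_at w F).
  by move=> r7; apply: nrich; apply: rich_split_below r7.
exists (fun w => \sum_x \sum_y \sum_z edge (split_at w F) x y z).
  move=> w; rewrite leqNgt; apply/negP => /kst_K22t [x0 [x1 [y0 [y1 [xx yy big]]]]].
  by apply: (nrich7 w); apply: HN xx yy big; apply: split_below.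
apply: leq_trans (card_split_sum F) _; rewrite leq_add2l leq_sum // => w _.
exact: card_le_edges (@split_below _ w F) (nrich7 w).
Qed.

(* The bound with a real exponent *)
From mathcomp Require Import all_order all_algebra.
From mathcomp Require Import all_classical all_reals all_analysis.
Import Order.TTheory GRing.Theory Num.Theory.

Local Open Scope ring_scope.

(** Eight regions exhaust the triples of bits, so the one prescribed by [S] occurs. *)
Lemma rich_full_venn (X : finType) (F : {set {set X}}) : rich 8 #|X| F ->
  exists A : 'I_3 -> {set X}, (forall i, A i \in F) /\ full_venn A.
Proof.
move=> [A [B [C [AF BF CF all8]]]].
exists (fun i : 'I_3 => nth A [:: A; B; C] i); split; first by case=> [[|[|[|]]] //].
move=> S; pose r := (inord 0 \in S, inord 1 \in S, inord 2 \in S).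
have full : [set region A B C p | p in below X #|X|] = [set: bool * bool * bool].
  by apply/eqP; rewrite eqEcard finset.subsetT finset.cardsT card_regions.
have : r \in [set: bool * bool * bool] by rewrite inE.
rewrite -full => /imsetP[p _ [e0 e1 e2]]; exists p => i.
have -> : i = inord i by rewrite inord_val.
case: i => [[|[|[|]]] //= _]; by rewrite inordK // -?e0 -?e1 -?e2.
Qed.

Theorem theorem3p3 (R : realType) :
  exists2 c : R, 0 < c &
    forall (X : finType) (F : {set {set X}}),
      (0 < #|X|)%N ->
      c * #|X|%:R `^ (4 - 1 / 4) < #|F|%:R ->
      exists A : 'I_3 -> {set X}, (forall i, A i \in F) /\ full_venn A.
Proof.
have [K HK] := card_not_rich.
(* The 4 pays for [1 + n + n ^ 2 + n ^ 3], the rest for the edges. *)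
exists (4 + 8 * K.+1%:R); first by rewrite ltr_wpDr // mulr_ge0.
move=> X F X0 big; apply: rich_full_venn; apply: contrapT => nr.
have [e le_e le_F] := HK X F nr.
move: big; rewrite ltNge => /negP; apply.
have n1 : 1 <= #|X|%:R :> R by rewrite ler1n.
set n := #|X|%:R in n1 *.
have n0 : 0 < n by apply: lt_le_trans n1.
have pow_le (k : nat) : (k%:R <= 4 - 1 / 4 :> R) -> n ^+ k <= n `^ (4 - 1 / 4).
  by move=> k4; rewrite -powR_mulrn ?(ltW n0) //; apply: ler_powR.
(* Fourth powers are compared; [K <= K.+1 ^ 4] avoids a fourth root of [K]. *)
have e_le w : (e w)%:R <= K.+1%:R * n `^ (11 / 4).
  rewrite -(@ler_pXn2r _ 4) ?nnegrE ?mulr_ge0 ?powR_ge0 //.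
  rewrite exprMn -[n `^ _ ^+ 4]powR_mulrn ?powR_ge0 // -powRrM.
  have -> : 11 / 4 * 4%:R = 11%:R :> R by rewrite divfK.
  rewrite powR_mulrn ?(ltW n0) //.
  apply: le_trans (_ : (K * #|X| ^ 11)%:R <= _); first by rewrite -natrX ler_nat.
  rewrite natrM natrX ler_pM2r ?exprn_gt0 // -natrX ler_nat.
  by apply: leq_trans (leqnSn K) _; rewrite -[X in (X <= _)%N]expn1 leq_pexp2l.
have step : (#|F|)%:R <= 1 + n * (1 + n + n ^+ 2 + 8 * (K.+1%:R * n `^ (11 / 4))) :> R.
  apply: le_trans (_ : (1 + \sum_w (1 + #|X| + #|X| ^ 2 + 8 * e w))%:R <= _).
    by rewrite ler_nat.
  rewrite natrD natr_sum lerD2l; set t := 1 + n + _ + _.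
  have -> : n * t = \sum_(w : X) t by rewrite sumr_const mulr_natl.
  rewrite ler_sum // => w _.
  by rewrite natrD natrM 2!natrD natrX lerD2l ler_pM2l.
apply: le_trans step _.
have -> : n * (1 + n + n ^+ 2 + 8 * (K.+1%:R * n `^ (11 / 4)))
   = n ^+ 1 + n ^+ 2 + n ^+ 3 + 8 * K.+1%:R * (n * n `^ (11 / 4)).
  by ring.
have -> : n * n `^ (11 / 4) = n `^ (4 - 1 / 4).
  rewrite -{1}[n]powRr1 ?(ltW n0) // -powRD; last by rewrite gt_eqF ?implybT.
  by congr (_ `^ _); lra.
have p0 : 1 <= n `^ (4 - 1 / 4) by apply: (pow_le 0%N); lra.
have p1 : n ^+ 1 <= n `^ (4 - 1 / 4) by apply: pow_le; lra.
have p2 : n ^+ 2 <= n `^ (4 - 1 / 4) by apply: pow_le; lra.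
have p3 : n ^+ 3 <= n `^ (4 - 1 / 4) by apply: pow_le; lra.
rewrite [leRHS]mulrDl addrA lerD2r.
by move: (n ^+ 1) (n ^+ 2) (n ^+ 3) (n `^ _) p0 p1 p2 p3 => *; lra.
Qed.
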